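(* Let $n\geq 5$ and let $g$ be a positive integer with $g\leq 2^{[\frac{n+1}{2}]}$. Then $$c\lambda_{g+1}(FQ_n)=(n+1)g-\frac{ex_g}{2},$$ where $ex_g=\max\{2|E(FQ_n[X])| : X\subseteq V(FQ_n),\ |X|=g\}$.
   Context: The $n$-dimensional hypercube $Q_n$ has as vertices all binary strings of length $n$, two vertices being adjacent iff they differ in exactly one coordinate. The folded hypercube $FQ_n$ is obtained from $Q_n$ by adding the perfect matching $\{u\bar u : u\in V(Q_n)\}$, where $\bar u$ is the bitwise complement of $u$; it is $(n+1)$-regular. For a non-complete graph $G$ and positive integer $k$, a $k$-component edge cut is a set of edges whose deletion leaves a graph with at least $k$ components, and the $k$-component edge connectivity $c\lambda_k(G)$ is the minimum size of a $k$-component edge cut. $FQ_n[X]$ denotes the subgraph induced by $X$. $[x]$ denotes the integer part of $x$. *)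

(* Defs.v *)
From mathcomp Require Import all_boot.

Set Implicit Arguments.
Unset Strict Implicit.
Unset Printing Implicit Defensive.

(* A finite simple graph is a symmetric irreflexive [e : rel T] on a finType;
   its edges are the unordered pairs [set x; y] with [e x y]. *)

Section Graphs.
Variables (T : finType) (e : rel T).
Implicit Types (F : {set {set T}}) (X : {set T}).

Definition edges : {set {set T}} :=
  [set [set p.1; p.2] | p : T * T & e p.1 p.2].

Definition induced_edges X : {set {set T}} := [set A in edges | A \subset X].

Definition delete_edges F : rel T :=
  [rel x y | e x y && ([set x; y] \notin F)].

Definition component_edge_cut (k : nat) F : bool :=
  (F \subset edges) && (k <= n_comp (delete_edges F) predT).

(* The default [edges] is itself a k-component edge cut exactly when k <= #|T|,
   which is when the minimum exists; the value is meaningless otherwise. *)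
Definition component_edge_connectivity (k : nat) : nat :=
  #|[arg min_(F < edges | component_edge_cut k F) #|F| ]|.

(* The maximum is over a nonempty family exactly when g <= #|T|. *)
Definition ex (g : nat) : nat :=
  \max_(X : {set T} | #|X| == g) 2 * #|induced_edges X|.

End Graphs.

Definition bitcompl n (u : n.-tuple bool) : n.-tuple bool := map_tuple negb u.

Definition hypercube n : rel (n.-tuple bool) :=
  fun u v => #|[set i | tnth u i != tnth v i]| == 1.

Definition folded_hypercube n : rel (n.-tuple bool) :=
  fun u v => hypercube u v || (v == bitcompl u).

Lemma folded_hypercube_sym n : symmetric (@folded_hypercube n).
Proof.
move=> u v; rewrite /folded_hypercube /hypercube; congr (_ || _).
  by congr (#|pred_of_set _| == 1); apply/setP=> i; rewrite !inE eq_sym.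
have bitcomplK : involutive (@bitcompl n).
  by move=> w; apply/eq_from_tnth=> i; rewrite !tnth_map negbK.
by rewrite -(inj_eq (inv_inj bitcomplK)) bitcomplK eq_sym.
Qed.

Lemma folded_hypercube_irr n : 0 < n -> irreflexive (@folded_hypercube n).
Proof.
case: n => // n _ u; apply/norP; split.
  rewrite /hypercube (_ : [set i | _] = set0) ?cards0 //.
  by apply/setP=> i; rewrite !inE eqxx.
apply/eqP=> eq_u; have := congr1 (fun w => tnth w ord0) eq_u.
by rewrite tnth_map; case: (tnth u ord0).
Qed.

(* Main.v *)
Require Import Defs.
From mathcomp Require Import all_boot.
From mathcomp Require Import zify.

Set Implicit Arguments.
Unset Strict Implicit.
Unset Printing Implicit Defensive.

(* Isolating an extremal set of size g costs (n+1)g - ex_g/2 edges. Conversely,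
   let V_0, ..., V_g be a partition with V_0 largest and boundaries d(V_i); the
   cut has at least (d(V_0) + ... + d(V_g))/2 edges. Deleting any one of the
   n+1 directions of FQ_n leaves a graph isomorphic to Q_n, so the bound
   2 e(X) <= lambda(|X|) for subsets of Q_n, with lambda the piecewise linear
   interpolation of m log2 m at the powers of 2, averages to
   n * 2 e(X) <= (n+1) lambda(|X|) in FQ_n. Put k = [(n+1)/2] and let M be the
   size of the complement X of V_0.
   - If M <= 2^(k+1), vertices of small degree show ex_M - ex_g <= 2(k+1)(M-g),
     and e(V_i) <= (n-k)(|V_i|-1) for i > 0; the two slopes add up to n+1.
   - Since ex at 2^k is at least k 2^k, ex_g >= (n+1)g - (n+1-k) 2^k; as every
     V_i with i > 0 has boundary at least n+1, it suffices otherwise to have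
     d(V_0) >= (n+1-k) 2^k. This holds when V_0 and X both have at least 2^(k+1)
     vertices.
   - If all V_i are smaller than 2^(k+1), each d(V_i) is at least (n-k-1)|V_i|.
   For n = 5 the same estimates need sharper constants. *)

(** * Edge-isoperimetry for commuting flips *)

(* The piecewise linear interpolation of m * log2 m at the powers of 2, for
   0 < m; the junk value at 0 is 0. *)
Definition dyadic m := \sum_(i < m.-1) (trunc_log 2 i.+1 + 2).

Lemma dyadicS m : 0 < m -> dyadic m.+1 = dyadic m + (trunc_log 2 m + 2).
Proof. by case: m => // m _; rewrite /dyadic big_ord_recr. Qed.

(** The increments at 2b and 2b+1 both exceed the increment at b by one, since doubling raises
    [trunc_log 2] by one. *)
Lemma dyadic_double b : 0 < b -> dyadic (2 * b) = 2 * dyadic b + 2 * b.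
Proof.
elim: b => // -[|b] IHb _; first by rewrite /dyadic big_ord_recl !big_ord0.
have tl d : d < 2 -> trunc_log 2 (2 * b.+1 + d) = (trunc_log 2 b.+1).+1.
  move=> d_lt2; apply: trunc_log_eq => //.
  by have /andP[] := trunc_log_bounds (isT : 1 < 2) (ltn0Sn b); rewrite !expnS; lia.
have := tl 0 isT; have := tl 1 isT; move: (IHb isT).
have -> : 2 * b.+2 = (2 * b.+1).+2 by lia.
have: 0 < 2 * b.+1 by [].
move: (2 * b.+1) => q q_gt0 Dq tl1 tl0; rewrite addn1 addn0 in tl1 tl0.
by rewrite (@dyadicS b.+1) // !(@dyadicS q.+1, @dyadicS q) // Dq tl0 tl1; lia.
Qed.

(** The increments of [dyadic] are nondecreasing, so its gain over a window of length b grows as the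
    window is shifted right. *)
Lemma dyadic_convex c b : 0 < b ->
  dyadic (c + b) + dyadic (b + b) <= dyadic (c + b + b) + dyadic b.
Proof.
move=> b_gt0; elim: c => [|c IHc]; first by rewrite addnC.
have le_tl: trunc_log 2 (c + b) <= trunc_log 2 (c + b + b).
  by apply: leq_trunc_log; lia.
by rewrite !addSn !(@dyadicS (c + b), @dyadicS (c + b + b)); lia.
Qed.

(* By convexity it is enough to treat a = b, where equality holds. *)
Lemma dyadic_superadd a b :
  b <= a -> dyadic a + dyadic b + 2 * b <= dyadic (a + b).
Proof.
case: (posnP b) => [-> _|b_gt0 le_ba]; first by rewrite addn0 /dyadic big_ord0 !addn0.
have := dyadic_convex (a - b) b_gt0.
by rewrite subnK // addnn -mul2n dyadic_double //; lia.
Qed.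

Lemma dyadic_expn j : dyadic (2 ^ j) = j * 2 ^ j.
Proof.
elim: j => [|j IHj]; first by rewrite /dyadic big_ord0.
by rewrite expnS dyadic_double ?expn_gt0 // IHj; lia.
Qed.

(** By convexity, chords from the point 1, where [dyadic] vanishes, have nondecreasing slope. *)
Lemma dyadic_secant p q : 0 < p <= q ->
  (q - 1) * dyadic p <= (p - 1) * dyadic q.
Proof.
case/andP=> p_gt0 /subnK <-; elim: (q - p) => // d IHd.
rewrite addSn dyadicS; last by lia.
suff: dyadic p <= (p - 1) * (trunc_log 2 (d + p) + 2) by nia.
rewrite /dyadic subn1 -[X in X * _]card_ord -sum_nat_const.
by apply: leq_sum => -[i lt_ip] _; rewrite leq_add2r leq_trunc_log //=; lia.
Qed.

Lemma dyadic_le j m : m <= 2 ^ j -> dyadic m <= j * m.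
Proof.
case: m => [|[|m]] le_m; try by rewrite /dyadic big_ord0.
have := @dyadic_secant m.+2 (2 ^ j) le_m; rewrite dyadic_expn => sec.
rewrite -(@leq_pmul2l (2 ^ j - 1)); last by lia.
apply: leq_trans sec _; rewrite mulnCA [leqRHS]mulnCA leq_mul2l.
by apply/orP; right; nia.
Qed.

(** Below [2 ^ n.-1] each increment of [dyadic] is at most (n - 2) + 2 = n. *)
Lemma dyadic_mono n p q : 0 < p <= q -> q <= 2 ^ n.-1 ->
  n * p + dyadic q <= n * q + dyadic p.
Proof.
case/andP=> p_gt0 /subnK <-; elim: (q - p) => [|d IHd] le_q; first by rewrite addnC.
rewrite addSn dyadicS; last by lia.
have lt_q: d + p < 2 ^ n.-1 by lia.
have: trunc_log 2 (d + p) < n.-1.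
  by rewrite -(@ltn_exp2l 2) // (leq_ltn_trans _ lt_q) // trunc_logP //; lia.
by have := IHd (ltnW lt_q); lia.
Qed.

(** Induction on the flips. The flip i exchanges the two halves of X cut out by [h i], so it
    contributes at most twice the smaller half; the other flips preserve the halves, and
    [dyadic_superadd] absorbs the sum. *)
Lemma flips_bound (T : finType) (I : eqType) (h : I -> T -> bool)
    (flip : I -> T -> T) (s : seq I) (X : {set T}) :
  uniq s -> {in s, forall i, injective (flip i)} ->
  {in s &, forall i j x, h i (flip j x) = (i == j) (+) h i x} ->
  \sum_(i <- s) #|[set x in X | flip i x \in X]| <= dyadic #|X|.
Proof.
elim: s X => [|i s IHs] X /=; first by rewrite big_nil.
case/andP=> s'i uniq_s inj_flip h_flip; rewrite big_cons.
pose X0 := [set x in X | h i x]; pose X1 := [set x in X | ~~ h i x].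
have cardX : #|X| = #|X0| + #|X1|.
  rewrite -(cardsID [set x | h i x] X); congr (_ + _); apply: eq_card => x;
  by rewrite !inE // andbC.
have le_i : #|[set x in X | flip i x \in X]| <= 2 * minn #|X0| #|X1|.
  have flip_i x : h i (flip i x) = ~~ h i x.
    by rewrite h_flip ?mem_head // eqxx.
  have inj_i : injective (flip i) by apply: inj_flip; rewrite mem_head.
  rewrite -(cardsID [set x | h i x]) mul2n -addnn.
  apply: leq_add; rewrite leq_min; apply/andP; split.
  - by apply/subset_leq_card/subsetP=> x; rewrite !inE -andbA => /and3P[-> _ ->].
  - rewrite -(card_imset _ inj_i); apply/subset_leq_card/subsetP=> _ /imsetP[x + ->].
    by rewrite !inE flip_i negbK -andbA => /and3P[_ -> ->].
  - rewrite -(card_imset _ inj_i); apply/subset_leq_card/subsetP=> _ /imsetP[x + ->].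
    by rewrite !inE flip_i => /and3P[-> _ ->].
  - by apply/subset_leq_card/subsetP=> x; rewrite !inE => /and3P[-> -> _].
have le_s : \sum_(j <- s) #|[set x in X | flip j x \in X]|
            <= dyadic #|X0| + dyadic #|X1|.
  have sub_s : {subset s <= i :: s} by move=> j js; rewrite inE js orbT.
  have {}IHs (Y : {set T}) : \sum_(j <- s) #|[set x in Y | flip j x \in Y]| <= dyadic #|Y|.
    by apply: IHs => // [j /sub_s|j1 j2 /sub_s + /sub_s]; [apply: inj_flip | apply: h_flip].
  apply: leq_trans (leq_add (IHs X0) (IHs X1)); rewrite -big_split /= big_seq.
  rewrite [leqRHS]big_seq; apply: leq_sum => j js.
  have flip_j x : h i (flip j x) = h i x.
    rewrite h_flip ?mem_head ?sub_s //; case: eqP => // eq_ij.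
    by rewrite eq_ij js in s'i.
  rewrite -(cardsID [set x | h i x]); apply: leq_add; apply/subset_leq_card/subsetP=> x;
  by rewrite !inE flip_j; case: (x \in X); case: (flip j x \in X); case: (h i x).
rewrite cardX; apply: leq_trans (leq_add le_i le_s) _.
have [le01|le10] := leqP #|X0| #|X1|.
  by rewrite addnC [#|X0| + _]addnC [dyadic _ + dyadic _]addnC dyadic_superadd.
by rewrite addnC dyadic_superadd // ltnW.
Qed.

(** * Counting ordered adjacent pairs *)

(** Pairs are ordered: an edge inside X counts twice in [arcs e X X], while a boundary edge counts
    once in [arcs e X (~: X)]. *)
Definition arcs (T : finType) (e : rel T) (X Y : {set T}) :=
  \sum_(x in X) #|[set y in Y | e x y]|.

Lemma card_edges (T : finType) (r : rel T) : symmetric r -> irreflexive r ->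
  2 * #|edges r| = arcs r setT setT.
Proof.
move=> r_sym r_irr.
have card2 A : A \in edges r -> #|A| = 2.
  case/imsetP=> -[x y]; rewrite inE /= => r_xy ->; rewrite cards2.
  by case: eqP => // eq_xy; rewrite eq_xy r_irr in r_xy.
transitivity (\sum_(A in edges r) \sum_(x in A) 1).
  rewrite mulnC -sum_nat_const; apply: eq_bigr => A /card2.
  by rewrite sum1_card.
rewrite (exchange_big_dep (mem [set: T])) //=; apply: eq_bigr => x _.
rewrite sum1dep_card -(@card_in_imset _ _ (fun y => [set x; y]) [set y in setT | r x y]).
  apply: eq_card => A; rewrite !inE; apply/andP/imsetP.
    case=> /imsetP[[y z]]; rewrite inE /= => r_yz -> /set2P[->|->].
      by exists z; rewrite ?inE.
    by exists y; rewrite ?inE 1?r_sym // setUC.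
  case=> y; rewrite !inE /= => r_xy ->; split; last exact: set21.
  by apply/imsetP; exists (x, y); rewrite ?inE.
move=> y z; rewrite !inE /= => r_xy r_xz /setP/(_ y).
rewrite !inE eqxx orbT; case: (y =P x) => [eq_yx|_ /esym/eqP //].
by rewrite eq_yx r_irr in r_xy.
Qed.

Section Arcs.
Variables (T : finType) (e : rel T).
Hypotheses (e_sym : symmetric e) (e_irr : irreflexive e).
Implicit Types X Y : {set T}.

Lemma arcsC X Y : arcs e X Y = arcs e Y X.
Proof.
have arcsE U V : arcs e U V = \sum_(x in U) \sum_(y in V | e x y) 1.
  by apply: eq_bigr => x _; rewrite sum1dep_card; apply: eq_card => y; rewrite !inE.
rewrite !arcsE (exchange_big_dep (mem Y)) /= => [|x y _ /andP[] //].
apply: eq_bigr => y Yy; apply: eq_bigl => x.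
by rewrite e_sym [y \in Y]Yy.
Qed.

Lemma arcsDr X Y : arcs e X Y + arcs e X (~: Y) = arcs e X setT.
Proof.
rewrite -big_split; apply: eq_bigr => x _ /=.
rewrite -(cardsID Y [set y in setT | e x y]); congr (_ + _); apply: eq_card => y;
by rewrite !inE // andbC.
Qed.

Lemma card_induced_edges X : 2 * #|induced_edges e X| = arcs e X X.
Proof.
pose r := [rel x y | [&& e x y, x \in X & y \in X]].
have -> : induced_edges e X = edges r.
  apply/setP=> A; rewrite inE; apply/andP/imsetP.
    case=> /imsetP[p]; rewrite inE => ep ->.
    by rewrite subUset !sub1set => /andP[X1 X2]; exists p; rewrite // inE /= ep X1.
  case=> p; rewrite inE /= => /and3P[ep X1 X2] ->.
  rewrite subUset !sub1set X1; split=> //.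
  by apply/imsetP; exists p; rewrite ?inE.
rewrite card_edges; first last.
- by move=> x; rewrite /= e_irr.
- by move=> x y; rewrite /= e_sym [(x \in X) && _]andbC.
rewrite /arcs [RHS]big_mkcond; apply: eq_big => [x|x _]; first by rewrite inE.
case: ifP => Xx; first by apply: eq_card => y; rewrite !inE /= Xx andbC.
by apply/eqP; rewrite cards_eq0; apply/eqP/setP=> y; rewrite !inE /= Xx andbF.
Qed.

Lemma arcsD1 X x : x \in X ->
  arcs e X X = arcs e (X :\ x) (X :\ x) + 2 * #|[set y in X | e x y]|.
Proof.
move=> Xx; have arcsD Y : arcs e X Y = #|[set y in Y | e x y]| + arcs e (X :\ x) Y.
  by rewrite /arcs (big_setD1 x).
have dx : #|[set y in X :\ x | e x y]| = #|[set y in X | e x y]|.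
  by apply: eq_card => y; rewrite !inE; case: eqP => // ->; rewrite e_irr !andbF.
by rewrite arcsD arcsC arcsD dx; lia.
Qed.

Lemma ex_witness m : m <= #|T| ->
  exists2 X : {set T}, #|X| = m & ex e m = arcs e X X.
Proof.
move=> le_m; have [X0 X0m] : exists X : {set T}, #|X| == m.
  exists [set x in take m (enum T)].
  by rewrite cardsE (card_uniqP _) ?take_uniq ?enum_uniq // size_takel // -cardE.
rewrite /ex (bigmax_eq_arg X0) //; case: arg_maxnP => // X /eqP <- _.
by exists X; rewrite ?card_induced_edges.
Qed.

Lemma arcs_le_ex X : arcs e X X <= ex e #|X|.
Proof.
by rewrite -card_induced_edges /ex (bigmax_sup X) .
Qed.

End Arcs.

(** * Directions of the folded hypercube *)

(* [None] is the direction of the complementary edges. *)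
Definition shift n (t : option 'I_n) (u : n.-tuple bool) : n.-tuple bool :=
  [tuple (if t is Some j then i == j else true) (+) tnth u i | i < n].

Lemma folded_hypercubeE n (u v : n.-tuple bool) :
  folded_hypercube u v = [exists t, v == shift t u].
Proof.
apply/orP/existsP=> [[/cards1P[j Dj]|/eqP->]|[[j|] /eqP->]].
- exists (Some j); apply/eqP/eq_from_tnth => i; rewrite tnth_mktuple.
  by have := in_set1 i j; rewrite -Dj inE => <-; do 2!case: (tnth _ _).
- by exists None; apply/eqP/eq_from_tnth => i; rewrite tnth_mktuple tnth_map.
- left; apply/cards1P; exists j; apply/setP=> i; rewrite !inE tnth_mktuple.
  by case: (i == j); case: (tnth u i).
- by right; apply/eqP/eq_from_tnth => i; rewrite tnth_mktuple tnth_map.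
Qed.

Lemma shiftK n t : involutive (@shift n t).
Proof. by move=> u; apply/eq_from_tnth => i; rewrite !tnth_mktuple addbA addbb. Qed.

(** For n = 1 complementing would be the same as flipping the only coordinate; with two coordinates
    some i distinguishes [None] from [Some j]. *)
Lemma shift_dir_inj n (u : n.-tuple bool) : 1 < n -> injective (fun t => shift t u).
Proof.
move=> n_gt1 t t' eq_tu.
have eq_dir i : (if t is Some j then i == j else true) =
                (if t' is Some j then i == j else true).
  have := congr1 (fun w => tnth w i) eq_tu; rewrite !tnth_mktuple.
  by do 3!case: (X in X (+) _ = _); case: (X in _ = X (+) _); case: (tnth u i).
have two j : exists i : 'I_n, i != j.
  apply/existsP; rewrite -negb_forall; apply/negP=> /forallP eq_j.
  have := max_card (pred1 j).
  suff: #|'I_n| <= #|pred1 j| by rewrite card_ord card1; lia.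
  by apply/subset_leq_card/subsetP=> i _; have:= eq_j i; rewrite inE.
case: t t' {eq_tu} eq_dir => [j|] [j'|] eq_dir //.
- by have := eq_dir j; rewrite eqxx => /esym/eqP->.
- by have [i /negPf ne_ij] := two j; have := eq_dir i; rewrite ne_ij.
- by have [i /negPf ne_ij] := two j'; have := eq_dir i; rewrite ne_ij.
Qed.

Lemma card_option_ord n : #|{: option 'I_n}| = n.+1.
Proof. by rewrite card_option card_ord. Qed.

Section FoldedHypercube.
Variable n : nat.
Hypothesis n_gt1 : 1 < n.
Notation FQ := (@folded_hypercube n).
Implicit Types X : {set n.-tuple bool}.

Lemma folded_hypercube_degree X u :
  #|[set v in X | FQ u v]| = #|[set t | shift t u \in X]|.
Proof.
rewrite -(card_imset _ (@shift_dir_inj n u n_gt1)); apply: eq_card => v.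
rewrite !inE folded_hypercubeE; apply/andP/imsetP.
  by case=> Xv /existsP[t /eqP Dv]; exists t; rewrite // inE -Dv.
by case=> t; rewrite inE => Xt ->; split=> //; apply/existsP; exists t.
Qed.

Lemma arcs_shift X :
  arcs FQ X X = \sum_t #|[set x in X | shift t x \in X]|.
Proof.
rewrite /arcs; under eq_bigr do rewrite folded_hypercube_degree -sum1dep_card.
rewrite (exchange_big_dep predT) //=; apply: eq_bigr => t _.
by rewrite sum1dep_card.
Qed.

Lemma arcs_setT X : arcs FQ X setT = n.+1 * #|X|.
Proof.
rewrite /arcs (eq_bigr (fun=> n.+1)) ?sum_nat_const 1?mulnC // => x _.
rewrite folded_hypercube_degree -card_option_ord; apply: eq_card => t.
by rewrite !inE.
Qed.

(* Coordinates in which the directions other than [t0] act as independent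
   flips: all directions sum to 0 over F_2, so those other than [t0] form a
   basis. *)
Definition missing_coord (t0 t : option 'I_n) (u : n.-tuple bool) : bool :=
  (if t is Some i then tnth u i else false) (+)
  (if t0 is Some j then tnth u j else false).

Lemma arcs_upper X : n * arcs FQ X X <= n.+1 * dyadic #|X|.
Proof.
have skip t0 : \sum_(t | t != t0) #|[set x in X | shift t x \in X]| <= dyadic #|X|.
  rewrite -big_filter.
  apply: (@flips_bound _ _ (missing_coord t0)).
  - by rewrite filter_uniq ?index_enum_uniq.
  - by move=> t _; apply: inv_inj (shiftK t).
  move=> t t'; rewrite !mem_filter => /andP[t_t0 _] /andP[t'_t0 _] x.
  (* Apart from the skipped direction [Some j], only the complement moves coordinate j. *)
  have t'_j j : t0 = Some j -> (if t' is Some k then j == k else true) = (t' == None).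
    move=> Dt0; case: t' t'_t0 => [k|//]; rewrite Dt0 eq_sym => /negPf ne_jk.
    exact: ne_jk.
  rewrite /missing_coord; case: t t_t0 => [i|]; case: t0 t'_t0 t'_j => [j|] //=.
  - move=> _ /(_ j erefl) t'_j _; rewrite !tnth_mktuple t'_j.
    by case: t' {t'_j} => [k|] /=; rewrite -?[Some i == Some k]/(i == k); case: (i == _) => /=; do 2!case: (tnth x _).
  - by case: t' => [k|//] _ _ _; rewrite tnth_mktuple !addbF.
  - move=> _ /(_ j erefl) t'_j _; rewrite !tnth_mktuple t'_j.
    by case: t' {t'_j}.
rewrite arcs_shift; set w := \sum_t _.
(* Each direction is skipped for exactly one of the n+1 choices of [t0], hence counted n times. *)
have -> : n * w = \sum_(t0 : option 'I_n) \sum_(t | t != t0) #|[set x in X | shift t x \in X]|.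
  have Dw t0 : \sum_(t | t != t0) #|[set x in X | shift t x \in X]| =
      w - #|[set x in X | shift t0 x \in X]|.
    by rewrite /w [in RHS](bigD1 t0) //= addKn.
  have le_w t0 : #|[set x in X | shift t0 x \in X]| <= w.
    by rewrite /w (bigD1 t0) //= leq_addr.
  under eq_bigr do rewrite Dw.
  rewrite sumnB // sum_nat_const card_option_ord.
  by rewrite -/w mulSn addKn.
rewrite -card_option_ord -sum_nat_const; apply: leq_sum => t0 _; exact: skip.
Qed.

End FoldedHypercube.

(** * Extremal sets and boundaries *)

Section FoldedHypercubeExtremal.
Variable n : nat.
Hypothesis n_gt1 : 1 < n.
Notation FQ := (@folded_hypercube n).
Implicit Types X V : {set n.-tuple bool}.

Let FQ_sym : symmetric FQ := @folded_hypercube_sym n.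
Let FQ_irr : irreflexive FQ := folded_hypercube_irr (ltnW n_gt1).

Lemma card_bits : #|{: n.-tuple bool}| = 2 ^ n.
Proof. by rewrite card_tuple card_bool. Qed.

(* An extremal set of size at most [2 ^ j] has average degree below [j + 1],
   so one of its vertices can be deleted at the cost of at most [j] edges. *)
Lemma ex_succ j m : j < n -> m < 2 ^ j -> ex FQ m.+1 <= ex FQ m + 2 * j.
Proof.
move=> lt_jn lt_m; have le_m : m.+1 <= #|{: n.-tuple bool}|.
  by rewrite card_bits (leq_trans lt_m) // leq_exp2l // ltnW.
have [X cardX ->] := ex_witness FQ_sym FQ_irr le_m.
have [x Xx le_x] : exists2 x, x \in X & #|[set y in X | FQ x y]| <= j.
  apply/exists_inP; rewrite -[X in is_true X]negbK negb_exists_in.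
  (* If all degrees exceeded j, then n(j+1) <= (n+1)j would follow, against j < n. *)
  apply/negP=> /forall_inP deg_gt.
  have: j.+1 * m.+1 <= arcs FQ X X.
    rewrite -cardX mulnC -sum_nat_const; apply: leq_sum => x Xx.
    by rewrite ltnNge deg_gt.
  have := arcs_upper n_gt1 X; have := @dyadic_le j m.+1 lt_m; rewrite cardX.
  by nia.
have -> : m = #|X :\ x| by have := cardsD1 x X; rewrite Xx cardX; lia.
by rewrite (arcsD1 FQ_sym FQ_irr Xx) leq_add ?arcs_le_ex // leq_mul2l le_x orbT.
Qed.

Lemma ex_le j g m : j < n -> g <= m <= 2 ^ j ->
  ex FQ m <= ex FQ g + 2 * j * (m - g).
Proof.
move=> lt_jn /andP[/subnK <-]; rewrite addnK.
elim: (m - g) => [|d IHd] le_m; first by rewrite muln0 addn0.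
apply: leq_trans (ex_succ lt_jn le_m) _.
by rewrite mulnSr addnA leq_add2r IHd // ltnW.
Qed.

(** [dyadic] lies below its chord from 1 to [2 ^ j]; the second hypothesis says that (n+1)/n times
    the slope of this chord is at most 2c. *)
Lemma arcs_le_linear j c X : 0 < #|X| <= 2 ^ j ->
    n.+1 * (j * 2 ^ j) <= 2 * n * (c * (2 ^ j - 1)) ->
  arcs FQ X X <= 2 * c * (#|X| - 1).
Proof.
case/andP=> X_gt0 X_le le_jc; have := arcs_upper n_gt1 X.
have := @dyadic_secant #|X| (2 ^ j); rewrite X_gt0 X_le dyadic_expn => /(_ isT).
have [X1|X_gt1] := leqP #|X| 1.
  have -> : #|X| = 1 by lia.
  by rewrite {2}/dyadic big_ord0; nia.
move=> sec up; rewrite -(@leq_pmul2l (n * (2 ^ j - 1))); last by nia.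
move: (2 ^ j) (dyadic _) (arcs _ _ _) sec up le_jc X_le => P d w sec up le_jc X_le.
apply: (@leq_trans (n.+1 * ((P - 1) * d))); first by nia.
apply: (@leq_trans (n.+1 * ((#|X| - 1) * (j * P)))); first by rewrite leq_mul2l sec orbT.
apply: (@leq_trans ((#|X| - 1) * (2 * n * (c * (P - 1))))); last by lia.
by rewrite mulnCA leq_mul2l le_jc orbT.
Qed.

(** The witness is the subcube of strings vanishing beyond the first k coordinates: k directions map
    it to itself. *)
Lemma ex_expn k : k <= n -> k * 2 ^ k <= ex FQ (2 ^ k).
Proof.
move=> le_kn.
pose pad (u : k.-tuple bool) : n.-tuple bool := [tuple nth false u i | i < n].
have pad_inj : injective pad.
  move=> u v eq_uv; apply/eq_from_tnth => i.
  have := congr1 (fun w => tnth w (widen_ord le_kn i)) eq_uv.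
  by rewrite !tnth_mktuple !(tnth_nth false).
pose X := [set pad u | u in setT].
have cardX : #|X| = 2 ^ k.
  by rewrite card_imset // cardsT card_tuple card_bool.
rewrite -cardX; apply: leq_trans (arcs_le_ex FQ_sym FQ_irr X).
rewrite arcs_shift // -{1}[k]card_ord -sum_nat_const.
pose dir (i : 'I_k) : option 'I_n := Some (widen_ord le_kn i).
have dir_inj : injective dir by move=> i j [] /val_inj.
rewrite (eq_bigr (fun i => #|[set x in X | shift (dir i) x \in X]|)).
  have -> : \sum_(i < k) #|[set x in X | shift (dir i) x \in X]| =
            \sum_(t in dir @: setT) #|[set x in X | shift t x \in X]|.
    rewrite big_imset /=; last by move=> i j _ _; apply: dir_inj.
    by apply: eq_bigl => i; rewrite inE.
  by rewrite [leqRHS](bigID (mem (dir @: setT))) /= leq_addr.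
move=> i _; apply: eq_card => x; rewrite !inE; case: imsetP => //= -[u _ ->].
apply/esym/imsetP; exists [tuple (j == i) (+) tnth u j | j < k] => //.
apply/eq_from_tnth => j; rewrite !tnth_mktuple.
have [lt_jk|le_kj] := ltnP j k.
  by rewrite -[nat_of_ord j]/(nat_of_ord (Ordinal lt_jk)) -!tnth_nth tnth_mktuple.
rewrite !nth_default ?size_tuple // addbF; apply/eqP=> /(congr1 val) /= eq_ji.
by have := ltn_ord i; rewrite -eq_ji ltnNge le_kj.
Qed.

Lemma boundary_eq V : arcs FQ V V + arcs FQ V (~: V) = n.+1 * #|V|.
Proof. by rewrite arcsDr arcs_setT. Qed.

Lemma boundaryC V : arcs FQ (~: V) (~: ~: V) = arcs FQ V (~: V).
Proof. by rewrite setCK arcsC. Qed.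

Lemma boundary_lower V :
  n.+1 * (n * #|V|) <= n * arcs FQ V (~: V) + n.+1 * dyadic #|V|.
Proof. by have := arcs_upper n_gt1 V; have := boundary_eq V; nia. Qed.

(** As n m - [dyadic] m is nondecreasing up to [2 ^ n.-1], the bound may be evaluated at any
    positive size below that of V. *)
Lemma boundary_lower_from m V : 0 < m <= #|V| -> #|V| <= 2 ^ n.-1 ->
  n.+1 * (n * m) <= n * arcs FQ V (~: V) + n.+1 * dyadic m.
Proof.
move=> le_m le_V; have := boundary_lower V; have := dyadic_mono le_m le_V.
by nia.
Qed.

Lemma boundary_lower_linear c m b :
  n.+1 * (n * m) <= n * b + n.+1 * (c * m) -> (n - c) * m <= b.
Proof.
move=> le_b; rewrite -(@leq_pmul2l n); last by lia.
apply: (@leq_trans (n.+1 * ((n - c) * m))); first by rewrite leq_mul2r leqnSn orbT.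
by rewrite mulnBl mulnBr leq_subLR addnC.
Qed.

Lemma boundary_gt0 V : 0 < #|V| <= 2 ^ n.-1 -> n < arcs FQ V (~: V).
Proof.
case/andP=> V_gt0 V_le; have := @boundary_lower_from 1 V; rewrite V_gt0 => /(_ isT V_le).
by rewrite {1}/dyadic big_ord0; nia.
Qed.

End FoldedHypercubeExtremal.

(** * Lower bound for partitions into g+1 classes *)

Section PartitionBound.
Variables (n g : nat) (I : finType) (p : n.-tuple bool -> I).
Let k := n.+1 %/ 2.
Hypotheses (n_ge5 : 5 <= n) (g_le : g <= 2 ^ k).
Hypotheses (cardI : #|I| = g.+1) (p_surj : forall i, exists x, p x = i).
Notation FQ := (@folded_hypercube n).
Let V i := [set x | p x == i].
Let bd i := arcs FQ (V i) (~: V i).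
Variable i0 : I.
Hypothesis i0_max : forall i, #|V i| <= #|V i0|.

Let n_gt1 : 1 < n. Proof. exact: leq_trans n_ge5. Qed.

Let card_others : #|[pred i | i != i0]| = g.
Proof. by have := cardC1 i0; rewrite cardI. Qed.

Let sum_V : \sum_i #|V i| = 2 ^ n.
Proof.
rewrite -card_bits -sum1_card (partition_big p predT) //=.
by apply: eq_bigr => i _; rewrite sum1dep_card.
Qed.

Let V_gt0 i : 0 < #|V i|.
Proof. by have [x <-] := p_surj i; apply/card_gt0P; exists x; rewrite inE. Qed.

Let sum_others : #|V i0| + \sum_(i | i != i0) #|V i| = 2 ^ n.
Proof. by rewrite -sum_V [RHS](bigD1 i0). Qed.

Let card_VC : #|~: V i0| = \sum_(i | i != i0) #|V i|.
Proof. by have := cardsC (V i0); rewrite card_bits -sum_others => /addnI. Qed.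

Let others_le i : i != i0 -> #|V i| <= 2 ^ n.-1.
Proof.
move=> i'0; have := i0_max i; have := sum_others; rewrite (bigD1 i) //=.
by have -> : 2 ^ n = 2 * 2 ^ n.-1; [rewrite -expnS prednK //; lia | lia].
Qed.

Let sum_bd : \sum_i bd i = bd i0 + \sum_(i | i != i0) bd i.
Proof. by rewrite (bigD1 i0). Qed.

Let le_gM : g <= \sum_(i | i != i0) #|V i|.
Proof. by rewrite -card_others -sum1_card; apply: leq_sum. Qed.

(** [bd0] bounds the boundary of the largest class through its complement, [bd1] sums the other
    boundaries. Their slopes 2j and 2c in M add up to 2(n+1), so M cancels. *)
Lemma cut_small_complement j c : j < n -> j + c = n.+1 ->
    n.+1 * (j * 2 ^ j) <= 2 * n * (c * (2 ^ j - 1)) ->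
    #|~: V i0| <= 2 ^ j ->
  2 * n.+1 * g <= ex FQ g + \sum_i bd i.
Proof.
set M := \sum_(i | i != i0) #|V i|; have cardM : #|~: V i0| = M := card_VC.
rewrite cardM => lt_jn jc le_jc le_M.
have bd0 : n.+1 * M <= ex FQ g + 2 * j * (M - g) + bd i0.
  rewrite -[bd i0]boundaryC -cardM -(boundary_eq n_gt1) leq_add2r.
  apply: leq_trans (arcs_le_ex (@folded_hypercube_sym n) _ _) _.
    exact/folded_hypercube_irr/ltnW.
  by rewrite ex_le // cardM le_gM.
have bd1 : n.+1 * M + 2 * c * g <= \sum_(i | i != i0) bd i + 2 * c * M.
  have le_sum : \sum_(i | i != i0) (n.+1 * #|V i| + 2 * c) <=
        \sum_(i | i != i0) (bd i + 2 * c * #|V i|).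
    apply: leq_sum => i i'0; rewrite -(boundary_eq n_gt1).
    have le_Vi : 0 < #|V i| <= 2 ^ j.
      by rewrite V_gt0 (leq_trans _ le_M) // /M (bigD1 i) //= leq_addr.
    have := arcs_le_linear n_gt1 le_Vi le_jc; rewrite mulnBr muln1.
    rewrite leq_subRL ?leq_pmulr ?V_gt0 // => le_w.
    by rewrite addnAC addnC leq_add2l addnC.
  rewrite [leqLHS]big_split [leqRHS]big_split /= sum_nat_const card_others in le_sum.
  by rewrite -!big_distrr /= [g * _]mulnC in le_sum.
have dM : M - g + g = M by rewrite subnK.
rewrite sum_bd; move: bd0 bd1; rewrite -dM addnK; nia.
Qed.

Let others_bd : n.+1 * g <= \sum_(i | i != i0) bd i.
Proof.
rewrite mulnC -card_others -sum_nat_const; apply: leq_sum => i i'0.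
by apply: boundary_gt0; rewrite ?V_gt0 ?others_le.
Qed.

Let k_bounds : 2 * k <= n.+1 <= 2 * k + 1.
Proof. by rewrite /k; lia. Qed.

(** Descending from [2 ^ k] to g loses at most 2k per vertex, and what remains is (n+1-2k)g <=
    (n+1-2k) [2 ^ k]. *)
Lemma ex_lower : n.+1 * g <= ex FQ g + (n.+1 - k) * 2 ^ k.
Proof.
have /andP[k_lo k_hi] := k_bounds.
have lt_kn : k < n by lia.
have le1 : k * 2 ^ k <= ex FQ (2 ^ k) := ex_expn n_gt1 (ltnW lt_kn).
have le2 : ex FQ (2 ^ k) <= ex FQ g + 2 * k * (2 ^ k - g).
  by rewrite ex_le // g_le leqnn.
have [d Dd] : exists d, 2 ^ k = g + d by exists (2 ^ k - g); rewrite subnKC.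
have [e De] : exists e, n.+1 = 2 * k + e by exists (n.+1 - 2 * k); lia.
have Dke : n.+1 - k = k + e by lia.
by rewrite Dke De; move: le1 le2; rewrite Dd addKn; nia.
Qed.

Lemma cut_large_boundary :
  (n.+1 - k) * 2 ^ k <= bd i0 -> 2 * n.+1 * g <= ex FQ g + \sum_i bd i.
Proof. by rewrite sum_bd; have := others_bd; have := ex_lower; lia. Qed.

Lemma cut_bound_ge6 : 6 <= n -> 2 * n.+1 * g <= ex FQ g + \sum_i bd i.
Proof.
move=> n_ge6; have /andP[k_lo k_hi] := k_bounds.
have P_ge : 8 <= 2 ^ k by rewrite -[8]/(2 ^ 3) leq_exp2l //; lia.
have P_ge' : n < 2 * k -> 16 <= 2 ^ k.
  by move=> lt_nk; rewrite -[16]/(2 ^ 4) leq_exp2l //; lia.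
have DB : 2 ^ k.+1 = 2 * 2 ^ k by rewrite expnS.
(* Here d + 2 = n - k. Either n = 2k, or n = 2k - 1 and then n >= 7 forces k >= 4. *)
have [d Dd] : exists d, n = k + d.+2 by exists (n - k - 2); lia.
have d_eq : d.+2 = k \/ d.+3 = k /\ 3 < k by lia.
have [le_B|gt_B] := leqP #|~: V i0| (2 ^ k.+1).
  apply: (@cut_small_complement k.+1 (n - k)) => //; try lia.
  have -> : n - k = d.+2 by lia.
  rewrite DB Dd; move: (2 ^ k) P_ge P_ge' => P P_ge P_ge'.
  by case: d_eq => [Dk|[Dk k_gt3]]; [|have := P_ge' ltac:(lia)]; rewrite -Dk; nia.
have [le_0|lt_0] := leqP (2 ^ k.+1) #|V i0|.
  apply: cut_large_boundary.
  (* At size [2 ^ k.+1] the boundary bound is (n-k-1) [2 ^ k.+1], which suffices because n - k >=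
     3. *)
  have large (X : {set n.-tuple bool}) : 2 ^ k.+1 <= #|X| <= 2 ^ n.-1 ->
      (n.+1 - k) * 2 ^ k <= arcs FQ X (~: X).
    case/andP=> X_ge X_le; have := @boundary_lower_from n n_gt1 (2 ^ k.+1) X.
    rewrite X_ge expn_gt0 dyadic_expn => /(_ isT X_le) low.
    apply: leq_trans (boundary_lower_linear n_gt1 low).
    have -> : n.+1 - k = d.+3 by lia.
    have -> : n - k.+1 = d.+1 by lia.
    by rewrite DB; nia.
  have D2n : 2 ^ n = 2 * 2 ^ n.-1 by rewrite -expnS prednK //; lia.
  have := cardsC (V i0); rewrite card_bits D2n => sumC.
  (* Both sides share the same boundary; [large] is applied to one with at most half of the
     vertices. *)
  have [le_half|gt_half] := leqP #|V i0| (2 ^ n.-1); first by rewrite large ?le_0.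
  by rewrite /bd -boundaryC large // ltnW //= -(leq_add2l #|V i0|) sumC; lia.
have low i : d.+1 * #|V i| <= bd i.
  have lt_i : #|V i| <= 2 ^ k.+1 by rewrite (leq_trans (i0_max i)) // ltnW.
  have := boundary_lower n_gt1 (V i); have := dyadic_le lt_i; rewrite -/(bd i).
  move=> le_d le_b; have -> : d.+1 = n - k.+1 by lia.
  apply: (boundary_lower_linear n_gt1); apply: leq_trans le_b _.
  by rewrite leq_add2l leq_mul2l le_d orbT.
have {}low : d.+1 * 2 ^ n <= \sum_i bd i.
  by rewrite -sum_V big_distrr; apply: leq_sum => i _; apply: low.
have := ex_lower; have -> : n.+1 - k = d.+3 by lia.
(* [ex_lower] accounts for one copy of (n+1)g, and g <= [2 ^ k] bounds the other. *)
suff: n.+1 * 2 ^ k + d.+3 * 2 ^ k <= d.+1 * 2 ^ n.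
  have : n.+1 * g <= n.+1 * 2 ^ k by rewrite leq_mul2l g_le orbT.
  by move: low; lia.
rewrite {2}Dd expnD; case: d_eq => [Dk|[Dk k_gt3]].
  by rewrite Dk; nia.
have -> : d.+2 = k.-1 by lia.
have D2k : 2 ^ k = 2 * 2 ^ k.-1 by rewrite -expnS prednK //; lia.
by have := P_ge' ltac:(lia); rewrite D2k; nia.
Qed.

(** When [V i0] and its complement both exceed 8 vertices, the available bound on [bd i0] is 20,
    short of the 24 asked by [ex_lower]. Some other class has two vertices, and its boundary of at
    least 10 instead of 6 makes up the missing 4. *)
Lemma cut_bound_5 : n = 5 -> 2 * n.+1 * g <= ex FQ g + \sum_i bd i.
Proof.
move=> Dn; have Dn1 : n.+1 = 6 by lia.
have Dk : k = 3 by rewrite /k Dn1.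
have low : 6 * g <= ex FQ g + 24 by have := ex_lower; rewrite Dk Dn1.
have others : 6 * g <= \sum_(i | i != i0) bd i by rewrite -Dn1.
have [le8|gt8] := leqP #|~: V i0| (2 ^ 3).
  by apply: (@cut_small_complement 3 3); rewrite // ?Dn1 // Dn.
have half : 2 ^ n.-1 = 16 by rewrite -subn1 Dn.
have sum32 : #|V i0| + #|~: V i0| = 32.
  by rewrite card_VC sum_others (_ : n = 5).
have dyadic8 m : m <= 8 -> dyadic m <= 3 * m by apply: (@dyadic_le 3).
(* The slack of 5 rounds the boundary bound up to an integer. *)
have bd_ge (X : {set n.-tuple bool}) m c : 0 < m <= #|X| -> #|X| <= 16 ->
    6 * dyadic m + 5 * c < 30 * m + 5 -> c <= arcs FQ X (~: X).
  rewrite -half => le_m X_le; have := boundary_lower_from n_gt1 le_m X_le.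
  by rewrite Dn1; move: (arcs _ _ _) => b; nia.
have g_le8 : g <= 8 by move: g_le; rewrite Dk.
have [gt8'|le8'] := ltnP 8 #|V i0|; last first.
  (* Since [dyadic] m <= 3m here, 5 times the boundary sum is at least 12 * 32 = 384; the sum thus
     exceeds the required 24 + 48. *)
  have sum12 : \sum_i 12 * #|V i| <= \sum_i 5 * bd i.
    apply: leq_sum => i _; have le_i := leq_trans (i0_max i) le8'.
    have := boundary_lower n_gt1 (V i); have := dyadic8 _ le_i.
    rewrite Dn1 -/(bd i); move: (bd i) => b; move: (#|V i|) (dyadic _) => m d.
    by rewrite Dn; lia.
  rewrite -!big_distrr /= sum_V in sum12.
  have D2n : 2 ^ n = 32 by rewrite (_ : n = 5).
  by rewrite Dn1; lia.
have dyadic9 : dyadic 9 = 29 by rewrite dyadicS // (dyadic_expn 3).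
have bd0 : 20 <= bd i0.
  have [le16|gt16] := leqP #|V i0| 16; first by rewrite (bd_ge _ 9) ?dyadic9.
  rewrite /bd -boundaryC (bd_ge _ 9) ?dyadic9 //.
  by rewrite -(leq_add2l #|V i0|) sum32; lia.
have [i1 i1'0 V1] : exists2 i, i != i0 & 2 <= #|V i|.
  (* Otherwise the complement of [V i0] would consist of g <= 8 singletons. *)
  apply/exists_inP; rewrite -[X in is_true X]negbK negb_exists_in.
  apply/negP=> /forall_inP le1; suff: #|~: V i0| <= g by lia.
  rewrite card_VC -card_others -sum1_card; apply: leq_sum => i i'0.
  by rewrite leqNgt le1.
have bd1 : 10 <= bd i1.
  have := others_le i1'0; rewrite half => le16.
  by rewrite (bd_ge _ 2) ?V1 // (dyadic_expn 1).
have {}others : 6 * (g - 1) <= \sum_(i | (i != i0) && (i != i1)) bd i.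
  have -> : g - 1 = #|[pred i | (i != i0) && (i != i1)]|.
    rewrite -card_others (cardD1 i1) inE i1'0 addKn; apply: eq_card => i.
    by rewrite !inE andbC.
  rewrite mulnC -sum_nat_const; apply: leq_sum => i /andP[i'0 _].
  by rewrite -Dn1; apply: boundary_gt0; rewrite ?V_gt0 ?others_le.
by rewrite sum_bd (bigD1 i1) //= Dn1; lia.
Qed.

End PartitionBound.

(** * Component cuts and partitions *)

Section ComponentCuts.
Variables (T : finType) (e : rel T).
Hypotheses (e_sym : symmetric e) (e_irr : irreflexive e).
Implicit Types (F : {set {set T}}) (X : {set T}).

Lemma connect_delete_sym F : connect_sym (delete_edges e F).
Proof. by apply: sym_connect_sym => x y; rewrite /delete_edges /= e_sym setUC. Qed.

Lemma connect_isolated (r : rel T) x y :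
  (forall z, ~~ r x z) -> connect r x y -> y = x.
Proof.
move=> iso_x /connectP[[|z s] /= + ->] //.
by rewrite (negPf (iso_x z)).
Qed.

Lemma isolated_root F x : (forall z, ~~ delete_edges e F x z) ->
  x \in roots (delete_edges e F).
Proof.
by move=> iso_x; apply/eqP; apply: connect_isolated iso_x _; apply: connect_root.
Qed.

Lemma component_edge_cut_partition g F : component_edge_cut e g.+1 F ->
  exists2 p : T -> 'I_g.+1, forall i, exists x, p x = i &
    \sum_i arcs e [set x | p x == i] (~: [set x | p x == i]) <= 2 * #|F|.
Proof.
set r := delete_edges e F; case/andP=> F_sub n_comps.
pose R := [set x in roots r].
have cardR : g < #|R|.
  by apply: leq_trans n_comps _; apply/subset_leq_card/subsetP=> x /andP[rx _]; rewrite inE.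
(* Components are numbered by their roots; those of index at least g are merged into the last
   class. *)
pose p x : 'I_g.+1 := inord (minn (index (root r x) (enum R)) g).
exists p => [i|].
  have [x0 _] : exists x0, x0 \in R by apply/card_gt0P; lia.
  have lt_i : i < size (enum R) by rewrite -cardE (leq_trans (ltn_ord i)).
  have := mem_nth x0 lt_i; rewrite mem_enum inE => /eqP root_i.
  exists (nth x0 (enum R) i); apply/ord_inj; rewrite /p root_i index_uniq ?enum_uniq //.
  have le_ig : i <= g by rewrite -ltnS.
  by rewrite (minn_idPl le_ig) inordK.
pose q : rel T := [rel x y | e x y && (p x != p y)].
(* An edge outside F stays within one component, hence within one class. *)
have q_sub : edges q \subset F.
  apply/subsetP=> A /imsetP[[x y]]; rewrite inE /= => /andP[exy ne_p] ->.
  apply: contraR ne_p => F'xy; apply/eqP; rewrite /p.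
  suff -> : root r x = root r y by [].
  by apply/(rootP (connect_delete_sym F))/connect1; rewrite /r /delete_edges /= exy.
apply: leq_trans (leq_mul (leqnn 2) (subset_leq_card q_sub)).
rewrite card_edges; first last.
- by move=> x; rewrite /q /= e_irr.
- by move=> x y; rewrite /q /= e_sym eq_sym.
rewrite [leqRHS](partition_big p predT) //=; apply: leq_sum => i _.
rewrite /arcs leq_eqVlt; apply/orP; left; apply/eqP; apply: eq_big => [x|x].
  by rewrite !inE.
rewrite inE => /eqP <-; apply: eq_card => y; rewrite !inE /q /= andbC.
by rewrite [p x == _]eq_sym.
Qed.

Lemma component_edge_cut_edges k : k <= #|T| -> component_edge_cut e k (edges e).
Proof.
move=> le_k; rewrite /component_edge_cut subxx; apply: leq_trans le_k _.
apply/subset_leq_card/subsetP=> x _; rewrite !inE andbT.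
apply: isolated_root => z /=; apply/negP=> /andP[exz /negP]; apply.
by apply/imsetP; exists (x, z); rewrite ?inE.
Qed.

(** Deleting every edge that meets X isolates its vertices and leaves at least one component
    outside. *)
Lemma isolating_edge_cut X : #|X| < #|T| ->
  exists2 F, component_edge_cut e #|X|.+1 F &
    2 * #|F| = arcs e X setT + arcs e X (~: X).
Proof.
move=> lt_X; pose r : rel T := [rel x y | e x y && ((x \in X) || (y \in X))].
exists (edges r); last first.
  rewrite card_edges; first last.
  - by move=> x; rewrite /r /= e_irr.
  - by move=> x y; rewrite /r /= e_sym orbC.
  rewrite {1}/arcs (bigID (mem X)) /=; congr (_ + _).
    apply: eq_big => [x|x /andP[_ Xx]]; first by rewrite inE.
    by apply: eq_card => y; rewrite !inE /r /= Xx andbT.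
  rewrite [RHS]arcsC //; apply: eq_big => [x|x /andP[_ X'x]]; first by rewrite !inE.
  by apply: eq_card => y; rewrite !inE /r /= (negPf X'x) andbC.
apply/andP; split.
  apply/subsetP=> A /imsetP[p]; rewrite inE /= => /andP[ep _] ->.
  by apply/imsetP; exists p; rewrite ?inE.
set d := delete_edges e (edges r).
have iso x z : x \in X -> ~~ d x z.
  move=> Xx; apply/negP=> /andP[exz /negP]; apply.
  by apply/imsetP; exists (x, z); rewrite // inE /r /= exz Xx.
have [y X'y] : exists y, y \in ~: X.
  by apply/card_gt0P; have := cardsC X; lia.
rewrite inE in X'y.
(* The root of y gives one component beyond the singletons of X. *)
have X'ry : root d y \notin X.
  apply: contra X'y => Xry; have := connect_root d y.
  by rewrite connect_delete_sym => /(connect_isolated (iso _ ^~ Xry)) ->.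
have <- : #|root d y |: X| = #|X|.+1 by rewrite cardsU1 X'ry.
apply/subset_leq_card/subsetP=> x /setU1P[->|Xx]; rewrite !inE andbT.
  by apply: roots_root; apply: connect_delete_sym.
by apply: isolated_root => z; apply: iso.
Qed.

End ComponentCuts.

(* Both operations on nat are exact: [ex] is a maximum of even numbers, and
   it is at most n.+1 * g since the graph is n.+1-regular. *)
Theorem theorem12 (n g : nat) (n_ge5 : 5 <= n) (g_gt0 : 0 < g)
    (g_le : g <= 2 ^ (n.+1 %/ 2)) :
  component_edge_connectivity (@folded_hypercube n) g.+1 =
    n.+1 * g - ex (@folded_hypercube n) g %/ 2.
Proof.
have n_gt1 : 1 < n by apply: leq_trans n_ge5.
have FQ_sym := @folded_hypercube_sym n.
have FQ_irr := folded_hypercube_irr (ltnW n_gt1).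
have g_lt : g < #|{: n.-tuple bool}|.
  by rewrite card_bits (leq_ltn_trans g_le) // ltn_exp2l //; lia.
have [X cardX exX] := ex_witness FQ_sym FQ_irr (ltnW g_lt).
have [F0] : exists2 F, component_edge_cut (@folded_hypercube n) g.+1 F &
    2 * #|F| + ex (@folded_hypercube n) g = 2 * (n.+1 * g).
  have := @isolating_edge_cut _ _ FQ_sym FQ_irr X; rewrite cardX => /(_ g_lt)[F cutF cardF].
  exists F => //; rewrite cardF exX arcs_setT // cardX.
  by rewrite -addnA [_ + arcs _ X X]addnC boundary_eq // cardX addnn mul2n.
rewrite exX -card_induced_edges // mulKn // => cutF0 cardF0.
rewrite /component_edge_connectivity; case: arg_minnP => [|F cutF minF].
  exact: component_edge_cut_edges.
(* Minimality against [F0] gives the upper bound; the lower bound is stated doubled to avoid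
   halves. *)
have := minF _ cutF0; suff: 2 * n.+1 * g <= ex (@folded_hypercube n) g + 2 * #|F|.
  by rewrite exX -card_induced_edges //; lia.
have [p p_surj le_F] := component_edge_cut_partition FQ_sym FQ_irr cutF.
apply: leq_trans (leq_add (leqnn _) le_F).
have cardI : #|'I_g.+1| = g.+1 by rewrite card_ord.
have [i0 _ i0_max] := @arg_maxnP _ ord0 predT (fun i => #|[set x | p x == i]|) isT.
have {}i0_max i : #|[set x | p x == i]| <= #|[set x | p x == i0]| by apply: i0_max.
have [n_ge6|n_le5] := leqP 6 n; first exact: cut_bound_ge6 i0_max n_ge6.
by apply: cut_bound_5 i0_max _ => //; lia.
Qed.
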